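(* (i) Let $G$ be a group and let $<$ be a discrete order on $G$. Then there exists an element $z$ in the center $Z(G)$ such that $\langle z\rangle$ is convex under $<$ and $1 \rightarrowtail \langle z\rangle$ is a convex jump of $(G,<)$. (ii) Conversely, if $G$ is an orderable group and its center $Z(G)$ contains an isolated infinite cyclic subgroup, then there is a discrete order on $G$.
   Context: An order on a group $G$ is a strict total order $<$ on the set $G$ such that $f<g$ implies both $fh<gh$ and $hf<hg$ for all $f,g,h\in G$; $G$ is orderable if such an order exists. The order $<$ is discrete if there is an element $a\in G$ with $1<a$ such that no element of $G$ lies strictly between $1$ and $a$ (in particular the order on the trivial group is not discrete). A subset $X$ of $G$ is convex if $x<y<z$ and $x,z\in X$ imply $y\in X$. A convex jump $C\rightarrowtail D$ is a pair of distinct convex subgroups $C\subset D$ with no convex subgroup strictly between them; here $1$ also denotes the trivial subgroup. A subgroup $H$ of a group $K$ is isolated in $K$ if $g\in K$ and $g^n\in H$ for some integer $n>0$ imply $g\in H$; in (ii) ''isolated'' means isolated in $Z(G)$. *)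

(* Defs.v *)
From mathcomp Require Import all_boot.
From mathcomp Require Import boolp classical_sets cardinality.

Set Implicit Arguments.
Unset Strict Implicit.
Unset Printing Implicit Defensive.

Local Open Scope classical_set_scope.
Local Open Scope group_scope.

(* Groups are arbitrary (possibly infinite) [groupType]s, and orders are
   strict, Prop-valued relations, unrelated to the [porderType] hierarchy. *)

Record group_order (G : groupType) (lt : G -> G -> Prop) : Prop := GroupOrder {
  group_order_irr : forall x, ~ lt x x;
  group_order_trans : forall x y z, lt x y -> lt y z -> lt x z;
  group_order_total : forall x y, x <> y -> lt x y \/ lt y x;
  group_order_mulr : forall f g h, lt f g -> lt (f * h) (g * h);
  group_order_mull : forall f g h, lt f g -> lt (h * f) (h * g)
}.

Definition orderable (G : groupType) : Prop :=
  exists lt : G -> G -> Prop, group_order lt.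

Definition discrete (G : groupType) (lt : G -> G -> Prop) : Prop :=
  exists a : G, lt 1 a /\ ~ (exists g : G, lt 1 g /\ lt g a).

Definition convex (G : groupType) (lt : G -> G -> Prop) (X : set G) : Prop :=
  forall x y z : G, lt x y -> lt y z -> X x -> X z -> X y.

Definition subgroup (G : groupType) (H : set G) : Prop :=
  group_closed (mem H).

Definition convex_subgroup (G : groupType) (lt : G -> G -> Prop) (C : set G) :
  Prop := subgroup C /\ convex lt C.

Definition convex_jump (G : groupType) (lt : G -> G -> Prop) (C D : set G) :
  Prop :=
  [/\ convex_subgroup lt C, convex_subgroup lt D, C `<` D &
      ~ (exists E : set G, [/\ convex_subgroup lt E, C `<` E & E `<` D])].

Definition center (G : groupType) : set G :=
  [set z : G | forall g : G, commute z g].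
Arguments center : clear implicits.

Definition cycle_of (G : groupType) (z : G) : set G :=
  [set x : G | exists n : nat, x = z ^+ n \/ x = z ^- n].

Definition infinite_cyclic (G : groupType) (H : set G) : Prop :=
  infinite_set H /\ exists z : G, H = cycle_of z.

(* H is isolated in K, for a subgroup H of K. *)
Definition isolated (G : groupType) (K H : set G) : Prop :=
  forall (g : G) (n : nat), K g -> (0 < n)%N -> H (g ^+ n) -> H g.

(* Main.v *)
(* (i) The least element above 1 is fixed by every conjugation, hence central,
   and it generates the least nontrivial convex subgroup.

   (ii) Let Z = <z> with z > 1 be isolated in the center. It suffices to order
   G / Z, since Z itself is then placed below everything else. Let N be the
   convex hull of Z and let K consist of those g in N for which some power g^q
   (q > 0) is infinitely close, relative to z, to some w in Z. As z is central,
   g and its conjugates have the same asymptotic ratio to z, so [N, G] <= K.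
   - G / N inherits the given order.
   - N / K is torsion-free, abelian and centralized by G, so any order on it,
     obtained from Zorn's lemma, is invariant.
   - K / Z is ordered by g > 1 iff g^q > w. If g^q = w, then g is central
     because roots are unique in an ordered group, so g is in Z as Z is
     isolated.
   These orders are combined lexicographically. *)
Require Import Defs.
From mathcomp Require Import all_boot.
From mathcomp Require Import boolp classical_sets cardinality.

Set Implicit Arguments.
Unset Strict Implicit.

Local Open Scope classical_set_scope.
Local Open Scope group_scope.

(** * Subgroups and positive cones on quotients *)

Section Subgroups.
Variables (G : groupType).

Lemma subgroup1 (H : set G) : subgroup H -> H 1.
Proof. by case=> /set_mem. Qed.

Lemma subgroupV (H : set G) x : subgroup H -> H x -> H x^-1.
Proof. by move=> sH /mem_set Hx; apply/set_mem/(group_closedV sH). Qed.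

Lemma subgroupM (H : set G) x y : subgroup H -> H x -> H y -> H (x * y).
Proof.
by move=> sH /mem_set Hx /mem_set Hy; apply/set_mem/(group_closedM sH).
Qed.

Lemma subgroupX (H : set G) x n : subgroup H -> H x -> H (x ^+ n).
Proof.
move=> sH Hx; elim: n => [|n IHn]; first exact: subgroup1.
by rewrite expgS; apply: subgroupM.
Qed.

Lemma subgroupI (H : set G) : H 1 ->
  (forall x y, H x -> H y -> H (x * y)) -> (forall x, H x -> H x^-1) ->
  subgroup H.
Proof.
move=> H1 HM HV; split=> [|x y]; first exact/mem_set.
by move=> /set_mem Hx /set_mem Hy; apply/mem_set/HM/HV.
Qed.

Definition normal_subgroup (H : set G) : Prop :=
  subgroup H /\ forall x g, H x -> H (x ^ g).

(* [Q] is the set of positive elements of an order on the quotient [X / L],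
   pulled back to [X], which is moreover invariant under conjugation by [G]. *)
Record relative_cone (X L Q : set G) : Prop := RelativeCone {
  cone_sub : Q `<=` X;
  cone_disj : forall x, Q x -> ~ L x;
  cone_mul : forall x y, Q x -> Q y -> Q (x * y);
  cone_mulr : forall x y, Q x -> L y -> Q (x * y);
  cone_conj : forall x g, Q x -> Q (x ^ g);
  cone_total : forall x, X x -> [\/ L x, Q x | Q x^-1]
}.

(** The lexicographic order on [X / L]: a sign is read in [X / Y] first, and in [Y / L] only for
    elements of [Y]. *)
Lemma relative_cone_lex (X Y L Q R : set G) :
  normal_subgroup Y -> L `<=` Y -> Y `<=` X ->
  relative_cone X Y Q -> relative_cone Y L R -> relative_cone X L (Q `|` R).
Proof.
move=> [sY nY] LY YX cQ cR; split.
- by move=> x [/(cone_sub cQ)|/(cone_sub cR)/YX].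
- by move=> x [/(cone_disj cQ) nYx /LY|/(cone_disj cR)].
- move=> x y [Qx|Rx] [Qy|Ry].
  + by left; apply: cone_mul cQ _ _ Qx Qy.
  + by left; apply: cone_mulr cQ _ _ Qx (cone_sub cR Ry).
  (* Here [x] lies in [Y]; moving it to the right of [y] turns it into [x ^ y], still in [Y] by
     normality. *)
  + left; rewrite conjgC; apply: (cone_mulr cQ Qy).
    exact/nY/(cone_sub cR).
  + by right; apply: cone_mul cR _ _ Rx Ry.
- move=> x y [Qx|Rx] Ly.
  + by left; apply: cone_mulr cQ _ _ Qx (LY _ Ly).
  + by right; apply: cone_mulr cR _ _ Rx Ly.
- by move=> x g [Qx|Rx]; [left; exact: cone_conj cQ _ _ Qx
                         |right; exact: cone_conj cR _ _ Rx].
- move=> x /(cone_total cQ)[/(cone_total cR)[]|Qx|Qx]; first by constructor 1.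
  + by constructor 2; right.
  + by constructor 3; right.
  + by constructor 2; left.
  + by constructor 3; left.
Qed.

(** Left invariance is built into [x^-1 * y]; right invariance is the conjugation invariance of the
    cone. *)
Lemma relative_cone_order (Q : set G) :
  relative_cone setT [set 1] Q -> group_order (fun x y => Q (x^-1 * y)).
Proof.
move=> cQ; split.
- by move=> x; rewrite mulVg => /(cone_disj cQ); apply.
- by move=> x y w xy /(cone_mul cQ xy); rewrite -mulgA mulVKg.
- move=> x y xy; case: (cone_total cQ (x := x^-1 * y)) => //.
  + move/mulg1_eq; rewrite invgK => /xy //.
  + by left.
  + by rewrite invgM invgK; right.
- move=> f g h /(cone_conj cQ h).
  by rewrite conjgE invgM !mulgA.
- by move=> f g h; rewrite invgM mulgA mulgVK.
Qed.

(** * Ordering a torsion-free quotient that the group centralizes *)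

Section TorsionFreeAbelianQuotient.
Variables N K : set G.
Hypotheses (sN : subgroup N) (nK : normal_subgroup K) (KN : K `<=` N).
Hypothesis commK : forall x g, N x -> K [~ x, g].
Hypothesis isoK : isolated N K.

Let sK : subgroup K. Proof. by case: nK. Qed.

(* A partial version of [relative_cone], satisfied by the empty set. *)
Let partial_cone (S : set G) : Prop :=
  [/\ S `<=` N, forall x, S x -> ~ K x,
      forall x y, S x -> S y -> S (x * y) &
      forall x y, S x -> K y -> S (x * y)].

(** Since [x ^ g] is [x] times [[~ x, g]], which lies in [K], conjugation does not move the coset of
    [x]. *)
Let partial_cone_conj S x g : partial_cone S -> S x -> S (x ^ g).
Proof.
case=> SN _ _ SK Sx; rewrite -[x ^ g](mulVKg x) -commgEl.
exact/SK/commK/SN.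
Qed.

(** The new cone consists of the products [s * a ^+ n] with [s] in [S], or with [s] in [K] and [n]
    positive. Such a product avoids [K]: by [noS] in the first case, by isolation of [K] in the
    second. *)
Let extend_cone (S : set G) (a : G) : N a -> ~ K a -> partial_cone S ->
  (forall n, (0 < n)%N -> ~ S (a ^- n)) ->
  exists S', [/\ partial_cone S', S `<=` S' & S' a].
Proof.
move=> Na nKa pS noS; have [SN SnK SM SK] := pS.
pose T n s := S s \/ K s /\ (0 < n)%N.
exists [set x | exists n s, T n s /\ x = s * a ^+ n]; split; last 2 first.
- by move=> s Ss; exists 0%N, s; split; [left | rewrite mulg1].
- exists 1%N, 1; split; last by rewrite mul1g.
  by right; split=> //; apply: subgroup1.
have TN n s : T n s -> N s by case=> [/SN|[/KN]].
have TJ n s g : T n s -> T n (s ^ g).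
  case=> [Ss|[Ks n0]]; first by left; apply: partial_cone_conj.
  by right; split=> //; case: nK => _; apply.
have TM n m s t : T n s -> T m t -> T (n + m)%N (s * t).
  move=> [Ss|[Ks n0]] [St|[Kt m0]].
  - by left; apply: SM.
  - by left; apply: SK.
  - by left; rewrite conjgC; apply: SK => //; case: nK => _; apply.
  - by right; split; [apply: subgroupM | rewrite addn_gt0 n0].
have TK n s k : T n s -> K k -> T n (s * k).
  by move=> [Ss|[Ks n0]] Kk; [left; apply: SK | right; split=> //;
    apply: subgroupM].
split.
- move=> x [n [s [Ts ->]]].
  by apply: subgroupM => //; [exact: TN Ts | exact: subgroupX].
- move=> x [n [s [Ts ->]]] Ksa; case: (posnP n) Ts Ksa => [->|n0] Ts Ksa.
    by case: Ts => [/SnK|[] //]; rewrite mulg1 in Ksa.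
  case: Ts => [Ss|[Ks _]].
    (* If [s * a ^+ n] is in [K], then [a ^- n] is [s] times a conjugate of its inverse, hence in
       [S]. *)
    apply: (noS n n0); rewrite -(mulgVK s (a ^- n)) -invgM conjgC.
    by apply: SK => //; case: nK => _; apply; apply: subgroupV.
  apply/nKa/(isoK Na n0); rewrite -[_ ^+ _](mulKg s).
  by apply: subgroupM => //; apply: subgroupV.
- move=> x y [n [s [Ts ->]]] [m [t [Tt ->]]].
  (* The conjugation of [t] comes from moving [a ^+ n] to its right. *)
  exists (n + m)%N, (s * t ^ (a ^- n)); split; first exact/TM/TJ.
  by rewrite mulgA -(mulgA s) (conjgCV _ t) expgnDr !mulgA.
- move=> x k [n [s [Ts ->]]] Kk.
  exists n, (s * k ^ (a ^- n)); split.
    by apply: TK => //; case: nK => _; apply.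
  by rewrite -mulgA (conjgCV _ k) mulgA.
Qed.

(** A cone maximal under inclusion is total. Otherwise, for some [x] outside [K], neither [x] nor
    [x^-1] could be added, so the cone contains a negative power of each; suitable powers of these
    two multiply to 1, which is in [K]. *)
Lemma exists_relative_cone : exists Q, relative_cone N K Q.
Proof.
have [F FP totF|S [pS maxS]] := @Zorn_bigcup G partial_cone.
  split.
  - by move=> x [X /FP[XN _ _ _] /XN].
  - by move=> x [X /FP[_ XK _ _] /XK].
  - move=> x y [X FX Xx] [Y FY Yy]; have [XY|YX] := totF _ _ FX FY.
      by exists Y => //; have [_ _ + _] := FP _ FY; apply=> //; exact: XY.
    by exists X => //; have [_ _ + _] := FP _ FX; apply=> //; exact: YX.
  - by move=> x y [X FX Xx] Ky; exists X => //; have [_ _ _] := FP _ FX; apply.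
have [SN SnK SM SK] := pS.
have SX x n : S x -> (0 < n)%N -> S (x ^+ n).
  case: n => // n Sx _; elim: n => [//|n IHn].
  by rewrite expgS; apply: SM.
have negpow a : N a -> ~ K a -> ~ S a -> exists2 n, (0 < n)%N & S (a ^- n).
  move=> Na nKa nSa; apply: contrapT => noS.
  have [n n0 Sn|S' [pS' SS' S'a]] := extend_cone Na nKa pS.
    by apply: noS; exists n.
  by apply: (maxS S') => //; split=> // /(_ _ S'a).
exists S; split=> //; first by move=> x g; apply: partial_cone_conj.
move=> x Nx; have [Kx|nKx] := pselect (K x); first by constructor 1.
have [Sx|nSx] := pselect (S x); first by constructor 2.
have [SxV|nSxV] := pselect (S x^-1); first by constructor 3.
have [n n0 Sn] := negpow x Nx nKx nSx.
have [||m m0 Sm] := negpow x^-1 _ _ nSxV.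
- exact: subgroupV.
- by move=> /(subgroupV sK); rewrite invgK.
have /SnK[] : S (x ^- n ^+ m * (x^-1 ^- m) ^+ n).
  by apply: SM; apply: SX.
rewrite !expVgn invgK -!expgnA mulnC mulVg.
exact: subgroup1.
Qed.

End TorsionFreeAbelianQuotient.

End Subgroups.

(** * Cyclic subgroups *)

Section CyclicSubgroup.
Variables (G : groupType) (z : G).

Lemma cycle_of1 : cycle_of z 1.
Proof. by exists 0%N; left. Qed.

Lemma cycle_ofX n : cycle_of z (z ^+ n).
Proof. by exists n; left. Qed.

Lemma cycle_ofV x : cycle_of z x -> cycle_of z x^-1.
Proof. by case=> n [] ->; exists n; [right | left; rewrite invgK]. Qed.

Lemma cycle_ofM x y : cycle_of z x -> cycle_of z y -> cycle_of z (x * y).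
Proof.
have mulz u : cycle_of z u -> cycle_of z (u * z).
  case=> n [] ->; first by rewrite -expgSr; exact: cycle_ofX.
  case: n => [|n]; first by rewrite invg1 mul1g; exact: (cycle_ofX 1).
  by exists n; right; rewrite expgS invgM mulgVK.
have mulzX u n : cycle_of z u -> cycle_of z (u * z ^+ n).
  elim: n u => [|n IHn] u zu; first by rewrite mulg1.
  by rewrite expgS mulgA; apply/IHn/mulz.
move=> zx [n [] ->]; first exact: mulzX.
have mulzXV u : cycle_of z u -> cycle_of z (u * z ^- n).
  case=> k [] ->; last by exists (n + k)%N; right; rewrite -invgM -expgnDr.
  rewrite -[_ * _]invgK invgM invgK; apply: cycle_ofV; rewrite -expVgn.
  have /orP[le|le] := leq_total k n.
    by exists (n - k)%N; left; rewrite expVgn expgnFr.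
  by exists (k - n)%N; right; rewrite expgnFr // invgM invgK expVgn.
exact: mulzXV.
Qed.

Lemma cycle_of_exp x n : cycle_of z x -> cycle_of z (x ^+ n).
Proof.
move=> zx; elim: n => [|n IHn]; first exact: cycle_of1.
by rewrite expgS; apply: cycle_ofM.
Qed.

Lemma cycle_of_inv : cycle_of z^-1 = cycle_of z.
Proof.
by apply/seteqP; split=> x [n [] ->]; exists n;
  rewrite !expVgn ?invgK; [right|left|right|left].
Qed.

Lemma cycle_of_min (E : set G) :
  subgroup E -> E z -> cycle_of z `<=` E.
Proof.
by move=> sE zE x [n [] ->]; last apply: subgroupV => //; exact: subgroupX.
Qed.

Lemma cycle_of_subgroup : subgroup (cycle_of z).
Proof.
apply: subgroupI; [exact: cycle_of1 | exact: cycle_ofM | exact: cycle_ofV].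
Qed.

Lemma cycle_of_center x : center G z -> cycle_of z x -> center G x.
Proof.
move=> cz [n [] ->] g; apply/commute_sym; last apply: commuteV;
  exact/commuteX/commute_sym/cz.
Qed.

Lemma cycle_of_normal : center G z -> normal_subgroup (cycle_of z).
Proof.
move=> cz; split=> [|x g zx]; first exact: cycle_of_subgroup.
by rewrite conjgE (cycle_of_center cz zx g) mulKg.
Qed.

End CyclicSubgroup.

(** * Inequalities, powers and roots in an ordered group *)

Section OrderedGroup.
Variables (G : groupType) (lt : G -> G -> Prop).
Hypothesis ltG : group_order lt.

Definition order_le (x y : G) : Prop := x = y \/ lt x y.

Local Notation "x '≺' y" := (lt x y) (at level 70).
Local Notation "x '≼' y" := (order_le x y) (at level 70).

Implicit Types x y g h : G.

Lemma le_refl x : x ≼ x. Proof. by left. Qed.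

Lemma ltW x y : x ≺ y -> x ≼ y. Proof. by right. Qed.

Lemma lt_le_trans x y w : x ≺ y -> y ≼ w -> x ≺ w.
Proof. by move=> xy [<- //|]; exact: group_order_trans. Qed.

Lemma le_lt_trans x y w : x ≼ y -> y ≺ w -> x ≺ w.
Proof. by case=> [-> //|]; exact: group_order_trans. Qed.

Lemma le_trans x y w : x ≼ y -> y ≼ w -> x ≼ w.
Proof. by case=> [-> //|xy] yw; apply/ltW/(lt_le_trans xy yw). Qed.

Lemma le_not_lt x y : x ≼ y -> ~ y ≺ x.
Proof. by move=> xy yx; exact: (group_order_irr ltG (le_lt_trans xy yx)). Qed.

Lemma le_or_lt x y : x ≼ y \/ y ≺ x.
Proof.
have [->|/(group_order_total ltG)[]] := pselect (x = y).
- by left; left.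
- by left; right.
- by right.
Qed.

Lemma le_anti x y : x ≼ y -> y ≼ x -> x = y.
Proof. by case=> // xy /le_not_lt. Qed.

Lemma le_total x y : x ≼ y \/ y ≼ x.
Proof. by case: (le_or_lt x y); [left | right; right]. Qed.

Lemma leM x y x' y' : x ≼ y -> x' ≼ y' -> x * x' ≼ y * y'.
Proof.
move=> xy xy'; apply: (@le_trans _ (y * x')).
  by case: xy => [->|?]; [left | right; exact: group_order_mulr].
by case: xy' => [->|?]; [left | right; exact: group_order_mull].
Qed.

Lemma ltM x y x' y' : x ≺ y -> x' ≼ y' -> x * x' ≺ y * y'.
Proof.
move=> xy xy'; apply: (lt_le_trans (group_order_mulr ltG x' xy)).
exact: leM (le_refl _) xy'.
Qed.

Lemma ltMr x y x' y' : x ≼ y -> x' ≺ y' -> x * x' ≺ y * y'.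
Proof.
move=> xy xy'; apply: (le_lt_trans _ (group_order_mull ltG y xy')).
exact: leM xy (le_refl _).
Qed.

Lemma ltV x y : x ≺ y -> y^-1 ≺ x^-1.
Proof.
move=> xy; have := group_order_mull ltG x^-1 (group_order_mulr ltG y^-1 xy).
by rewrite mulKg mulgV mulg1.
Qed.

Lemma leV x y : x ≼ y -> y^-1 ≼ x^-1.
Proof. by case=> [->|/ltV]; [left | right]. Qed.

Lemma leJ x y g : x ≼ y -> x ^ g ≼ y ^ g.
Proof. by move=> xy; apply: leM (le_refl _) (leM xy (le_refl _)). Qed.

Lemma ltJ x y g : x ≺ y -> x ^ g ≺ y ^ g.
Proof.
by move=> xy; apply: ltMr (le_refl _) _; apply: ltM xy (le_refl _).
Qed.

Lemma leX x y n : x ≼ y -> x ^+ n ≼ y ^+ n.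
Proof.
by move=> xy; elim: n => [|n IHn]; [left | rewrite !expgS; exact: leM].
Qed.

Lemma ltX x y n : (0 < n)%N -> x ≺ y -> x ^+ n ≺ y ^+ n.
Proof. by case: n => // n _ xy; rewrite !expgS; apply/ltM/leX/ltW. Qed.

Lemma le_expg_ge1 x n : 1 ≼ x -> (0 < n)%N -> x ≼ x ^+ n.
Proof.
case: n => // n x1 _; rewrite expgS -{1}[x]mulg1.
by apply: leM (le_refl _) _; rewrite -(expg1n _ n); exact: leX.
Qed.

Lemma expg_le x m n : 1 ≼ x -> (m <= n)%N -> x ^+ m ≼ x ^+ n.
Proof.
move=> x1 mn; rewrite -(subnK mn) expgnDr -{1}[x ^+ m]mul1g.
by apply: leM (le_refl _); rewrite -(expg1n _ (n - m)); exact: leX.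
Qed.

Lemma expg_lt x m n : 1 ≺ x -> (m < n)%N -> x ^+ m ≺ x ^+ n.
Proof.
move=> x1 mn; apply: lt_le_trans (expg_le (ltW x1) mn).
by rewrite expgS -{1}[x ^+ m]mul1g; apply: ltM x1 (le_refl _).
Qed.

Lemma expg_inj_pos x y n : (0 < n)%N -> x ^+ n = y ^+ n -> x = y.
Proof.
move=> n0 e; case: (le_or_lt x y) => [[//|xy]|yx].
  by case: (group_order_irr ltG (x := y ^+ n)); rewrite -{1}e; exact: ltX.
by case: (group_order_irr ltG (x := y ^+ n)); rewrite -{2}e; exact: ltX.
Qed.

(** Every conjugate of [x] has the same [n]-th power as [x], and roots are unique. *)
Lemma center_root x n : (0 < n)%N -> center G (x ^+ n) -> center G x.
Proof.
move=> n0 cx g; apply/commgP; rewrite -conjg_fix; apply/eqP.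
by apply: (@expg_inj_pos _ _ n) => //; rewrite -conjXg conjgE (cx g) mulKg.
Qed.

Lemma expgM_slide x y n : x * (y * x) ^+ n * y = (x * y) ^+ n.+1.
Proof.
elim: n => [|n IHn]; first by rewrite mulg1.
by rewrite expgSr !mulgA -(mulgA _ x y) IHn -expgSr.
Qed.

(** Induction by peeling off the outer factors: [y * (y * x) ^+ n * x] grows when the inner [y * x]
    is replaced by [x * y], and the result is [(y * x) ^+ n.+1]. The second bound is symmetric. *)
Lemma expgM_sandwich x y n : y * x ≼ x * y ->
  y ^+ n * x ^+ n ≼ (y * x) ^+ n /\ (x * y) ^+ n ≼ x ^+ n * y ^+ n.
Proof.
move=> yx; elim: n => [|n [IH1 IH2]]; first by rewrite !mulg1; split; left.
have slide (u v : G) : u ^+ n.+1 * v ^+ n.+1 = u * (u ^+ n * v ^+ n) * v.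
  by rewrite (expgS u) (expgSr v) !mulgA.
rewrite !slide -!expgM_slide; split; (apply: leM; last exact: le_refl);
  (apply: leM; first exact: le_refl).
- exact: le_trans IH1 (leX _ yx).
- exact: le_trans (leX _ yx) IH2.
Qed.

(** Whichever of [x * y] and [y * x] is larger, [(x * y) ^+ n] lies between [x ^+ n * y ^+ n] and
    [y ^+ n * x ^+ n]. This replaces commutativity in the estimates on ratios. *)
Lemma expgM_ge x y n w :
  w ≼ x ^+ n * y ^+ n -> w ≼ y ^+ n * x ^+ n -> w ≼ (x * y) ^+ n.
Proof.
move=> w1 w2; case: (le_total (y * x) (x * y)) => xy.
  by apply/(le_trans w2)/(le_trans _ (leX n xy)); case: (expgM_sandwich n xy).
by apply/(le_trans w1); case: (expgM_sandwich n xy).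
Qed.

Lemma expgM_gt x y n w :
  w ≺ x ^+ n * y ^+ n -> w ≺ y ^+ n * x ^+ n -> w ≺ (x * y) ^+ n.
Proof.
move=> w1 w2; case: (le_total (x ^+ n * y ^+ n) (y ^+ n * x ^+ n)) => xy.
  by apply: (lt_le_trans w1); apply: expgM_ge => //; left.
by apply: (lt_le_trans w2); apply: expgM_ge => //; left.
Qed.

Lemma expgM_le x y n w :
  x ^+ n * y ^+ n ≼ w -> y ^+ n * x ^+ n ≼ w -> (x * y) ^+ n ≼ w.
Proof.
move=> w1 w2; case: (le_total (y * x) (x * y)) => xy.
  by apply/le_trans/w1; case: (expgM_sandwich n xy).
by apply/le_trans/w2/(le_trans (leX n xy)); case: (expgM_sandwich n xy).
Qed.

(** * The chain of subgroups above a cyclic subgroup, and its cones *)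

Section CyclicSubgroupOrder.
Variable z : G.
Hypothesis z_gt1 : 1 ≺ z.

Local Notation Z := (cycle_of z).

Lemma cycle_of_ub x : Z x -> exists n, x ≼ z ^+ n.
Proof.
case=> n [] ->; first by exists n; left.
exists 0%N; rewrite -[z ^+ 0]invg1; apply/leV.
by rewrite -(expg1n _ n); apply/leX/ltW.
Qed.

Lemma cycle_of_gt1 x : Z x -> 1 ≺ x -> z ≼ x.
Proof.
case=> n [] -> x1; last first.
  case: (le_not_lt _ x1); rewrite -invg1; apply/leV.
  by rewrite -(expg1n _ n); apply/leX/ltW.
by case: n x1 => [/(group_order_irr ltG)//|n _]; exact: le_expg_ge1 (ltW _) _.
Qed.

(** Climb from [x] in steps of [z] until the next step would pass [g]; the upper bound [y] makes
    this stop. *)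
Lemma cycle_of_floor x y g : Z x -> Z y -> x ≼ g -> g ≼ y ->
  exists2 w, Z w & w ≼ g /\ g ≺ w * z.
Proof.
move=> Zx Zy xg gy.
have [n yn] := cycle_of_ub (cycle_ofM (cycle_ofV Zx) Zy).
(* One step more than [n] makes the bound strict, as the induction requires. *)
have {gy yn}: g ≺ x * z ^+ n.+1.
  apply: (le_lt_trans gy); rewrite -(mulVKg x y).
  apply: (ltMr (le_refl _)); apply: (le_lt_trans yn).
  exact: expg_lt z_gt1 _.
elim: n {Zy y} x Zx xg => [|n IHn] x Zx xg gx; first by exists x.
have [xzg|gxz] := le_or_lt (x * z) g; last by exists x.
apply: (IHn (x * z)) => //; first exact/cycle_ofM/(cycle_ofX _ 1).
by rewrite -mulgA -expgS.
Qed.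

Hypothesis cz : center G z.

Let Zcomm x g : Z x -> commute x g.
Proof. by move=> Zx; exact: cycle_of_center cz Zx g. Qed.

Let ZexpM x y n : Z x -> (x * y) ^+ n = x ^+ n * y ^+ n.
Proof. by move=> Zx; apply/expgMn/Zcomm. Qed.

Let ZJ x g : Z x -> x ^ g = x.
Proof. by move=> /Zcomm Zx; apply/conjg_fixP/commgP. Qed.

Definition cycle_hull : set G :=
  [set g | exists x y, [/\ Z x, Z y, x ≼ g & g ≼ y]].

Local Notation N := cycle_hull.

Lemma cycle_sub_hull : Z `<=` N.
Proof. by move=> x Zx; exists x, x; split=> //; left. Qed.

Lemma cycle_hull_normal : normal_subgroup N.
Proof.
split.
  apply: subgroupI; first exact/cycle_sub_hull/cycle_of1.
    move=> g h [x [y [Zx Zy xg gy]]] [x' [y' [Zx' Zy' xh hy]]].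
    by exists (x * x'), (y * y'); split;
      [exact: cycle_ofM | exact: cycle_ofM | exact: leM | exact: leM].
  move=> g [x [y [Zx Zy xg gy]]]; exists y^-1, x^-1.
  by split; [exact: cycle_ofV | exact: cycle_ofV | exact: leV | exact: leV].
move=> g h [x [y [Zx Zy xg gy]]]; exists x, y; split=> //.
  by rewrite -(ZJ h Zx); apply: leJ.
by rewrite -(ZJ h Zy); apply: leJ.
Qed.

(** An element outside the hull lacks an upper or a lower bound in [Z], so it lies above all of [Z]
    or below all of it. *)
Lemma cycle_hull_cone :
  relative_cone setT N [set g | forall x, Z x -> x ≺ g].
Proof.
split=> //.
- by move=> g Zg [x [y [_ /Zg yg _ /le_not_lt]]].
- move=> g h Zg Zh x /Zg xg; rewrite -[x]mulg1.
  exact/(ltM xg)/ltW/Zh/cycle_of1.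
- move=> g h Zg [y [_ [Zy _ yh _]]] x Zx; rewrite -(mulgVK y x).
  exact/ltM/yh/Zg/cycle_ofM/cycle_ofV.
- by move=> g h Zg x Zx; rewrite -(ZJ h Zx); apply/ltJ/Zg.
- move=> g _; have [[y Zy gy]|nub] := pselect (exists2 y, Z y & g ≼ y).
    have [[x Zx xg]|nlb] := pselect (exists2 x, Z x & x ≼ g).
      by constructor 1; exists x, y.
    constructor 3 => x Zx; rewrite -[x]invgK; apply: ltV.
    have [xg|//] := le_or_lt x^-1 g.
    by case: nlb; exists x^-1 => //; apply: cycle_ofV.
  constructor 2 => x Zx; have [gx|//] := le_or_lt g x.
  by case: nub; exists x.
Qed.

(* [ratio q g w]: the element [g ^+ q] agrees with [w] up to an error that is
   infinitely small compared with [z]. *)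
Definition ratio (q : nat) (g w : G) : Prop :=
  exists2 c, Z c &
    forall m, w ^+ m * c^-1 ≼ g ^+ (q * m) /\ g ^+ (q * m) ≼ w ^+ m * c.

Lemma ratio_cycle q x : ratio q x (x ^+ q).
Proof.
exists 1 => [|m]; first exact: cycle_of1.
by rewrite invg1 !mulg1 -expgnA; split; left.
Qed.

Lemma ratioX q r g w : ratio q g w -> ratio (q * r) g (w ^+ r).
Proof. by case=> c Zc gw; exists c => // m; rewrite -expgnA -mulnA. Qed.

(** The powers of [g] and [h], multiplied in either order, obey the bounds with error [c * d]; hence
    so do the powers of [g * h]. *)
Lemma ratioM q g h w w' : Z w -> Z w' ->
  ratio q g w -> ratio q h w' -> ratio q (g * h) (w * w').
Proof.
move=> Zw Zw' [c Zc gw] [d Zd hw]; exists (c * d) => [|m].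
  exact: cycle_ofM.
have [[wg gwc] [wh hwd]] := (gw m, hw m).
have swap u u' v v' : Z u -> Z u' -> Z v -> Z v' ->
    u * v * (u' * v') = u' * v' * (u * v) /\
    u * u' * (v * v') = u * v * (u' * v').
  move=> Zu Zu' Zv Zv'; split.
    by apply/Zcomm/cycle_ofM.
  by rewrite !mulgA -(mulgA u u') (Zcomm v Zu') mulgA.
have ZX u k : Z u -> Z (u ^+ k) by exact: cycle_of_exp.
rewrite (ZexpM _ _ Zw) (Zcomm d Zc) invgM; split.
  have [e1 ->] := swap (w ^+ m) (w' ^+ m) c^-1 d^-1
    (ZX _ _ Zw) (ZX _ _ Zw') (cycle_ofV Zc) (cycle_ofV Zd).
  by apply: expgM_ge; [| rewrite e1]; apply: leM.
rewrite (Zcomm c Zd).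
have [e1 ->] := swap (w ^+ m) (w' ^+ m) c d (ZX _ _ Zw) (ZX _ _ Zw') Zc Zd.
by apply: expgM_le; [| rewrite e1]; apply: leM.
Qed.

Lemma ratioV q g w : Z w -> ratio q g w -> ratio q g^-1 w^-1.
Proof.
move=> Zw [c Zc gw]; exists c => // m; have [wg gwc] := gw m.
have ZwX : Z (w ^+ m) by exact: cycle_of_exp.
rewrite !expVgn -{2}[c]invgK -!invgM; split; apply: leV.
  by rewrite -(Zcomm c ZwX).
by rewrite -(Zcomm c^-1 ZwX).
Qed.

Lemma ratioJ q g h w : Z w -> ratio q g w -> ratio q (g ^ h) w.
Proof.
move=> Zw [c Zc gw]; exists c => // m; have [wg gwc] := gw m.
have ZwX : Z (w ^+ m) by exact: cycle_of_exp.
rewrite -conjXg; split.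
  by rewrite -(ZJ h (cycle_ofM ZwX (cycle_ofV Zc))); apply: leJ.
by rewrite -(ZJ h (cycle_ofM ZwX Zc)); apply: leJ.
Qed.

(** If [w] is the power of [z] with integer exponent p, the asymptotic ratio of [g] to [z] is
    p/q. *)
Definition rational_ratio : set G :=
  [set g | N g /\ exists q w, [/\ (0 < q)%N, Z w & ratio q g w]].

Local Notation K := rational_ratio.

Lemma cycle_sub_rational : Z `<=` K.
Proof.
move=> x Zx; split; first exact: cycle_sub_hull.
by exists 1%N, x; split=> //; have := ratio_cycle 1 x; rewrite expg1.
Qed.

Lemma rational_normal : normal_subgroup K.
Proof.
have [sN nN] := cycle_hull_normal.
split.
  apply: subgroupI; first exact/cycle_sub_rational/cycle_of1.
    move=> g h [Ng [q [w [q0 Zw gw]]]] [Nh [r [v [r0 Zv hv]]]].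
    split; first exact: subgroupM.
    (* Addition of two fractions over the common denominator [q * r]. *)
    exists (q * r)%N, (w ^+ r * v ^+ q); split; first by rewrite muln_gt0 q0.
      by apply: cycle_ofM; apply: cycle_of_exp.
    apply: ratioM; [exact: cycle_of_exp|exact: cycle_of_exp|exact: ratioX|].
    by rewrite mulnC; exact: ratioX.
  move=> g [Ng [q [w [q0 Zw gw]]]]; split; first exact: subgroupV.
  by exists q, w^-1; split=> //; [exact: cycle_ofV | exact: ratioV].
move=> g h [Ng [q [w [q0 Zw gw]]]]; split; first exact: nN.
by exists q, w; split=> //; exact: ratioJ.
Qed.

(** For each [m], the powers [g ^+ m] and [(g ^ h) ^+ m] have the same floor [w] in [Z], as
    conjugation fixes [Z]. So all powers of [g^-1 * g ^ h] stay between [z^-1] and [z], and its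
    ratio to [z] is 0. *)
Lemma rational_commg g h : N g -> K [~ g, h].
Proof.
have [sN nN] := cycle_hull_normal.
move=> Ng; rewrite commgEl; split.
  by apply: subgroupM => //; [exact: subgroupV | exact: nN].
exists 1%N, 1; split=> //; first exact: cycle_of1.
have Zz : Z z by exact: (cycle_ofX z 1).
exists z => // m; rewrite mul1n expg1n !mul1g.
have [x [y [Zx Zy xg gy]]] := subgroupX m sN Ng.
have [w Zw [wg /ltW gwz]] := cycle_of_floor Zx Zy xg gy.
have wgh : w ≼ (g ^ h) ^+ m.
  by rewrite -conjXg -(ZJ h Zw); apply: leJ.
have ghwz : (g ^ h) ^+ m ≼ w * z.
  by rewrite -conjXg -(ZJ h (cycle_ofM Zw Zz)); apply: leJ.
have gV : (g^-1) ^+ m ≼ w^-1 by rewrite expVgn; apply: leV.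
have Vg : z^-1 * w^-1 ≼ (g^-1) ^+ m by rewrite expVgn -invgM; apply: leV.
split.
  apply: expgM_ge; rewrite -(mulgVK w z^-1); first exact: leM.
  by rewrite -(Zcomm _ Zw); apply: leM.
apply: expgM_le; rewrite -(mulKg w z); first exact: leM.
by rewrite (Zcomm _ (cycle_ofV Zw)); apply: leM.
Qed.

(** A ratio p/q for [g ^+ n] is a ratio p/(nq) for [g], with the same error. *)
Lemma rational_isolated : isolated N K.
Proof.
move=> g n Ng n0 [_ [q [w [q0 Zw [c Zc gw]]]]]; split=> //.
exists (n * q)%N, w; split; rewrite ?muln_gt0 ?n0 //; exists c => // m.
by rewrite -mulnA expgnA.
Qed.

Hypothesis isoZ : isolated (center G) Z.

Lemma rational_cone : relative_cone K Z
  [set g | N g /\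
     exists q w, [/\ (0 < q)%N, Z w, ratio q g w & w ≺ g ^+ q]].
Proof.
have [sN nN] := cycle_hull_normal.
split.
- by move=> g [Ng [q [w [q0 Zw gw _]]]]; split=> //; exists q, w.
- move=> g [_ [q [w [q0 Zw [c Zc gw] wg]]]] Zg.
  (* For [g] in [Z], the difference [w^-1 * g ^+ q] would be at least [z], so its powers would
     outgrow the fixed error [c]. *)
  have Zu : Z (w^-1 * g ^+ q).
    by apply: cycle_ofM; [exact: cycle_ofV | exact: cycle_of_exp].
  have u1 : z ≼ w^-1 * g ^+ q.
    apply: cycle_of_gt1 => //; rewrite -(mulVg w).
    exact: group_order_mull.
  have [n cn] := cycle_of_ub Zc.
  case: (le_not_lt cn); apply: (lt_le_trans (expg_lt z_gt1 (ltnSn n))).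
  apply: (le_trans (leX _ u1)).
  rewrite (ZexpM _ _ (cycle_ofV Zw)) -expgnA expVgn.
  rewrite -[c](mulKg (w ^+ n.+1)); apply: leM; first exact: le_refl.
  by case: (gw n.+1).
- move=> g h [Ng [q [w [q0 Zw gw wg]]]] [Nh [r [v [r0 Zv hv vh]]]].
  split; first exact: subgroupM.
  exists (q * r)%N, (w ^+ r * v ^+ q); split.
  + by rewrite muln_gt0 q0.
  + by apply: cycle_ofM; apply: cycle_of_exp.
  + apply: ratioM; [exact: cycle_of_exp|exact: cycle_of_exp|exact: ratioX|].
    by rewrite mulnC; exact: ratioX.
  + have wgr : w ^+ r ≺ g ^+ (q * r) by rewrite expgnA; exact: ltX.
    have vhq : v ^+ q ≺ h ^+ (q * r) by rewrite mulnC expgnA; exact: ltX.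
    apply: expgM_gt; first exact: ltM wgr (ltW vhq).
    by rewrite (Zcomm _ (cycle_of_exp r Zw)); apply: ltM vhq (ltW wgr).
- move=> g x [Ng [q [w [q0 Zw gw wg]]]] Zx.
  split; first by apply: subgroupM => //; exact: cycle_sub_hull.
  have ZxX : Z (x ^+ q) by exact: cycle_of_exp.
  exists q, (w * x ^+ q); split=> //; first exact: cycle_ofM.
    by apply: ratioM => //; exact: ratio_cycle.
  apply: expgM_gt; first exact: ltM wg (le_refl _).
  by rewrite -(Zcomm _ ZxX); apply: ltMr (le_refl _) wg.
- move=> g h [Ng [q [w [q0 Zw gw wg]]]]; split; first exact: nN.
  exists q, w; split=> //; first exact: ratioJ.
  by rewrite -conjXg -(ZJ h Zw); apply: ltJ.
- move=> g [Ng [q [w [q0 Zw gw]]]].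
  have [e|] := pselect (w = g ^+ q).
    constructor 1; apply: (isoZ _ q0); rewrite -?e //.
    by apply: (center_root q0); rewrite -e; exact: cycle_of_center Zw.
  case/(group_order_total ltG) => wg.
    by constructor 2; split=> //; exists q, w.
  constructor 3; split; first exact: subgroupV.
  exists q, w^-1; split=> //; [exact: cycle_ofV | exact: ratioV |].
  by rewrite expVgn; apply: ltV.
Qed.

Lemma cycle_cone : relative_cone Z [set 1] [set g | Z g /\ 1 ≺ g].
Proof.
split.
- by move=> g [].
- by move=> g [_ g1] e; apply: (group_order_irr ltG (x := 1)); rewrite -{2}e.
- move=> g h [Zg g1] [Zh h1]; split; first exact: cycle_ofM.
  by rewrite -[1]mulg1; apply: ltM g1 (ltW h1).
- by move=> g _ gP ->; rewrite mulg1.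
- by move=> g h [Zg g1]; rewrite /= ZJ.
- move=> g Zg; have [->|] := pselect (1 = g); first by constructor 1.
  case/(group_order_total ltG) => g1; first by constructor 2.
  by constructor 3; split; [exact: cycle_ofV | rewrite -invg1; apply: ltV].
Qed.

Lemma discrete_order_exists :
  exists lt' : G -> G -> Prop, group_order lt' /\ discrete lt'.
Proof.
have [sN nN] := cycle_hull_normal.
have KN : K `<=` N by move=> g [].
have [S cS] := exists_relative_cone sN rational_normal KN rational_commg
  rational_isolated.
(* The cones of [G / N], [N / K] and [K / Z] are glued in turn. *)
have [R cR] : exists R, relative_cone setT Z R.
  eexists; apply: relative_cone_lex cycle_hull_normal cycle_sub_hull _
    cycle_hull_cone _ => //.
  exact: relative_cone_lex rational_normal cycle_sub_rational KN cS
    rational_cone.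
have nZ := cycle_of_normal cz.
have Zz : Z z by exact: (cycle_ofX z 1).
have cP : relative_cone setT [set 1] (R `|` [set g | Z g /\ 1 ≺ g]).
  apply: relative_cone_lex nZ _ _ cR cycle_cone => // _ ->.
  exact: cycle_of1.
exists (fun x y => (R `|` [set g | Z g /\ 1 ≺ g]) (x^-1 * y)).
split; first exact: relative_cone_order.
exists z; split; first by rewrite invg1 mul1g; right.
(* If [g] lay strictly between 1 and [z], then [g] and [g^-1 * z] would be positive with product
   [z]. If either is in [R], then so is [z], although [z] is in [Z]; if both are in [Z], the given
   order already has [z ≼ g]. *)
move=> [g []]; rewrite invg1 mul1g => -[Rg|[Zg g1]] [Rgz|[Zgz gz1]].
- by have := cone_disj cR (cone_mul cR Rg Rgz); rewrite mulVKg.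
- by have := cone_disj cR (cone_mulr cR Rg Zgz); rewrite mulVKg.
- have := cone_disj cR (cone_mulr cR Rgz Zg).
  by rewrite -(Zcomm _ Zg) mulVKg.
- apply: (le_not_lt (cycle_of_gt1 Zg g1)).
  by have := group_order_mull ltG g gz1; rewrite mulVKg mulg1.
Qed.

End CyclicSubgroupOrder.

(** * The convex jump of a discrete order *)

Lemma discrete_jump : discrete lt ->
  exists z : G, [/\ center G z, convex lt (cycle_of z)
                   & convex_jump lt [set 1] (cycle_of z)].
Proof.
case=> z [z1 zmin].
have zle x : 1 ≺ x -> z ≼ x.
  by move=> x1; case: (le_or_lt z x) => // xz; case: zmin; exists x.
have zJ g : z ≼ z ^ g.
  by apply: zle; rewrite -(conj1g g); apply: ltJ.
have cz : center G z.
  (* The reverse inequality is [zJ] for [g^-1], conjugated by [g]. *)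
  move=> g; apply/commgP; rewrite -conjg_fix; apply/eqP/le_anti => //.
  by rewrite -{2}(conjgKV g z); apply: leJ.
have convZ : convex lt (cycle_of z).
  move=> x g y xg gy Zx Zy.
  (* Unless [g] equals its floor [w], the element [w^-1 * g] lies strictly between 1 and [z]. *)
  have [w Zw [[<- //|wg] gwz]] := cycle_of_floor z1 Zx Zy (ltW xg) (ltW gy).
  case: zmin; exists (w^-1 * g); split.
    by rewrite -(mulVg w); apply: group_order_mull.
  by rewrite -[z](mulKg w); apply: group_order_mull.
exists z; split=> //; split.
- split; last first.
    move=> x g y xg gy ex ey; case: (le_not_lt (ltW xg)).
    by rewrite ex -ey.
  apply: subgroupI => // [x y -> ->|x ->]; first by rewrite /= mulg1.
  by rewrite /= invg1.
- by split=> //; exact: cycle_of_subgroup.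
- split; first by move=> _ ->; exact: cycle_of1.
  move=> /(_ z (cycle_ofX z 1)) e.
  by case: (group_order_irr ltG (x := 1)); rewrite -{2}e.
- case=> E [[sE convE] [_ nE1] [EZ nZE]]; apply: nZE.
  (* A nontrivial subgroup has an element [x] above 1; then [z ≼ x], and convexity puts [z] in
     [E]. *)
  have [x Ex x1] : exists2 x, E x & 1 ≺ x.
    apply: contrapT => nE; apply: nE1 => x Ex.
    have [//|/(group_order_total ltG)[x1|x1]] := pselect (x = 1).
      case: nE; exists x^-1; first exact: subgroupV.
      by rewrite -invg1; apply: ltV.
    by case: nE; exists x.
  apply: cycle_of_min => //.
  case: (zle _ x1) => [-> //|zx].
  exact: convE z1 zx (subgroup1 sE) Ex.
Qed.

End OrderedGroup.

Theorem theorem2p1 (G : groupType) :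
  (forall lt : G -> G -> Prop,
     group_order lt -> discrete lt ->
     exists z : G,
       [/\ center G z, convex lt (cycle_of z)
         & convex_jump lt [set 1] (cycle_of z)])
  /\
  (orderable G ->
   (exists H : set G,
      [/\ subgroup H, H `<=` center G, infinite_cyclic H
        & isolated (center G) H]) ->
   exists lt : G -> G -> Prop, group_order lt /\ discrete lt).
Proof.
split=> [lt|[lt ltG] [H [sH HcG [infH [z Hz]] isoH]]].
  exact: discrete_jump.
move: sH HcG infH isoH; rewrite {}Hz => sZ ZcG infZ isoZ.
have cz : center G z by apply/ZcG/(cycle_ofX z 1).
(* Infinity of the subgroup excludes a trivial generator; a generator below 1 is replaced by its
   inverse. *)
have [z1|/(group_order_total ltG)[z1|z1]] := pselect (z = 1).
- case: infZ; have -> : cycle_of z = [set 1]; last exact: finite_set1.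
  rewrite z1; apply/seteqP; split=> [x [n [] ->]|x ->].
  + exact: expg1n.
  + by rewrite expg1n invg1.
  + exact: cycle_of1.
- apply: (@discrete_order_exists G lt ltG z^-1).
  + by rewrite -invg1; apply: ltV.
  + exact/ZcG/cycle_ofV/(cycle_ofX z 1).
  + by rewrite cycle_of_inv.
- exact: (@discrete_order_exists G lt ltG z).
Qed.
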